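(* Every $n$-node ternary tree admits a planar straight-line orthogonal grid drawing with width $O(n)$, height $O(n^{0.576})$, and area $O(n^{1.576})$.
   Context: A ternary tree is a rooted tree in which every node has at most three children. A planar straight-line orthogonal grid drawing of a tree maps each node to a distinct point with integer coordinates and each edge to a horizontal or vertical straight-line segment joining its end-nodes, so that no two edges cross (edges meet only at common end-nodes and no edge passes through a non-incident node). The width (resp. height) of a drawing is the number of vertical grid lines $x=\text{const}\in\mathbb{Z}$ (resp. horizontal grid lines $y=\text{const}\in\mathbb{Z}$) that intersect the drawing; the area is width times height. *)

(* Defs.v *)
From HB Require Import structures.
From mathcomp Require Import all_boot all_order all_algebra.
From mathcomp Require Import finmap.
From mathcomp Require Import all_classical all_reals all_analysis.
Set Implicit Arguments.
Unset Strict Implicit.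
Unset Printing Implicit Defensive.
Import Order.TTheory GRing.Theory Num.Theory.
Local Open Scope classical_set_scope.
Local Open Scope ring_scope.

(* [arc u v] means that [v] is a child of [u]. *)
Definition rooted_tree (V : finType) (root : V) (arc : rel V) : Prop :=
  (forall v, connect arc root v) /\
  (forall v, #|[set u | arc u v]%SET| = (if v == root then 0 else 1)%N).

Definition children (V : finType) (arc : rel V) (v : V) : {set V} :=
  [set w | arc v w]%SET.

Definition ternary_tree (V : finType) (root : V) (arc : rel V) : Prop :=
  rooted_tree root arc /\ forall v, (#|children arc v| <= 3)%N.

Section Drawings.
Variables (R : realType) (V : finType) (arc : rel V).
Variable pos : V -> int * int.

Definition point (v : V) : R * R := ((pos v).1%:~R, (pos v).2%:~R).

(* The closed segment of the real plane with end-points [a] and [b]. *)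
Definition segment (a b : R * R) : set (R * R) :=
  [set p | exists t : R, [/\ 0 <= t <= 1,
     p.1 = (1 - t) * a.1 + t * b.1 & p.2 = (1 - t) * a.2 + t * b.2]].

Definition edge_segment (e : V * V) : set (R * R) :=
  segment (point e.1) (point e.2).

Definition is_edge (e : V * V) : bool := arc e.1 e.2.

Definition incident (w : V) (e : V * V) : bool := (w == e.1) || (w == e.2).

Definition orthogonal_edge (e : V * V) : Prop :=
  (pos e.1).2 = (pos e.2).2 \/ (pos e.1).1 = (pos e.2).1.

Record planar_orthogonal_drawing : Prop := PlanarOrthogonalDrawing {
  drawing_inj : injective pos;
  drawing_orthogonal : forall e, is_edge e -> orthogonal_edge e;
  drawing_edges : forall e f, is_edge e -> is_edge f -> e != f ->
    forall p, edge_segment e p -> edge_segment f p ->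
    exists w, [/\ incident w e, incident w f & p = point w];
  drawing_nodes : forall e, is_edge e ->
    forall w, edge_segment e (point w) -> incident w e }.

Definition drawing_points : set (R * R) :=
  [set p | (exists v, p = point v) \/
           (exists2 e, is_edge e & edge_segment e p)].

Definition vertical_lines : set int :=
  [set k | exists2 p, drawing_points p & p.1 = k%:~R].

Definition horizontal_lines : set int :=
  [set k | exists2 p, drawing_points p & p.2 = k%:~R].

(* [fset_set] sends infinite sets to the empty one; the two sets of lines
   are finite since the drawing is a finite union of bounded sets. *)
Definition width : nat := #|` fset_set vertical_lines|%fset.

Definition height : nat := #|` fset_set horizontal_lines|%fset.

Definition area : nat := (width * height)%N.

End Drawings.

(* Main.v *)
(* A path of the tree through the root is placed on a horizontal line, and the
   other subtrees hang above and below it, each drawn recursively with its root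
   visible from the path.  Columns are only used for nodes, so the width is at
   most n; the height is one plus the maximal height hanging above plus the
   maximal height hanging below.  Order the children of each node by size,
   follow heaviest children, and let X and Y be the largest second and third
   child hanging from this heavy path.  The bound n^p is preserved if
   X^p + Y^p <= 0.98 n^p.  Otherwise some node s of the heavy path has a second
   child of size X, and Y is either the size of its third child or at most a
   third of the size of its heavy child h.  Now let the path leave the heavy
   path at the parent of s, so that s itself hangs from it.  The root s may use
   a path through its two largest children, so that s only costs
   max(Y, h/2)^p + (h/3)^p, and what hangs on the other side has size at most
   (n - |s|)/2.  For p = 4/7 < 0.576 the total is again at most 0.98 n^p, and
   the factor 0.98 absorbs the additive constants. *)
Require Import Defs.
From mathcomp Require Import all_boot all_order all_algebra.
From mathcomp Require Import finmap.
From mathcomp Require Import all_classical all_reals all_analysis.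
From mathcomp Require Import zify ring lra.
Import Order.TTheory GRing.Theory Num.Theory.
Local Open Scope ring_scope.

Set Implicit Arguments.
Unset Strict Implicit.
Unset Printing Implicit Defensive.

(** * Drawings on the integer grid *)

Definition between (a b c : int) : bool := (a <= c <= b) || (b <= c <= a).

(** This is the bounding rectangle of [a] and [b]. It is the segment between them once they share a
    coordinate, which [grid_orthogonal] grants for edges. *)
Definition on_segment (a b q : int * int) : bool :=
  between a.1 b.1 q.1 && between a.2 b.2 q.2.

(** Reflections in the axes followed by a translation: constructions are carried out on one side and
    mirrored to the other. *)
Definition signed_shift (sx sy : bool) (c q : int * int) : int * int :=
  ((if sx then - q.1 else q.1) + c.1, (if sy then - q.2 else q.2) + c.2).

Lemma signed_shift_inj sx sy c : injective (signed_shift sx sy c).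
Proof.
move=> [a b] [a' b']; rewrite /signed_shift /= => -[].
by case: sx; case: sy => ? ?; congr pair; lia.
Qed.

Lemma signed_shift_onto sx sy c q : exists q', q = signed_shift sx sy c q'.
Proof.
exists ((if sx then c.1 - q.1 else q.1 - c.1),
        (if sy then c.2 - q.2 else q.2 - c.2)).
by case: q => q1 q2; rewrite /signed_shift /=; case: sx; case: sy;
  congr pair; lia.
Qed.

Lemma signed_shift0K sx sy : involutive (signed_shift sx sy (0, 0)).
Proof.
by case=> a b; rewrite /signed_shift /=; case: sx; case: sy;
  rewrite ?addr0 ?opprK.
Qed.

Lemma on_segment_signed_shift sx sy c a b q :
  on_segment (signed_shift sx sy c a) (signed_shift sx sy c b)
    (signed_shift sx sy c q) =
  on_segment a b q.
Proof.
by rewrite /on_segment /between /signed_shift /=; case: sx; case: sy; lia.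
Qed.

Section GridDrawings.
Variable V : finType.
Implicit Types (N : seq V) (E : seq (V * V)) (pos : V -> int * int).
Implicit Types (Q : int * int -> Prop) (v w : V) (e f : V * V).

Definition on_edge pos e (q : int * int) : bool :=
  on_segment (pos e.1) (pos e.2) q.

(** Planarity is tested at grid points only, within reach of integer arithmetic; the lists [N] and
    [E] allow drawings of parts of a tree. *)
Record grid_planar N E pos : Prop := GridPlanar {
  grid_inj : {in N &, injective pos};
  grid_ends : forall e, e \in E -> e.1 \in N /\ e.2 \in N;
  grid_orthogonal : forall e, e \in E -> orthogonal_edge pos e;
  grid_edges : forall e f q, e \in E -> f \in E -> e != f ->
    on_edge pos e q -> on_edge pos f q ->
    exists w, [/\ incident w e, incident w f & q = pos w];
  grid_nodes : forall e w, e \in E -> w \in N -> on_edge pos e (pos w) ->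
    incident w e }.

Definition occupied N E pos (q : int * int) : Prop :=
  (exists2 v, v \in N & q = pos v) \/ (exists2 e, e \in E & on_edge pos e q).

(** [Q] is a region that contains the drawing. Gluing drawings then needs facts about regions only,
    not about positions. *)
Definition confined v N E Q : Prop :=
  exists pos, [/\ grid_planar N E pos, v \in N, pos v = (0, 0) &
                  forall q, occupied N E pos q -> Q q].

Lemma confinedW v N E Q Q' :
  (forall q, Q q -> Q' q) -> confined v N E Q -> confined v N E Q'.
Proof. by move=> QQ' [pos [? ? ? H]]; exists pos; split=> // q /H /QQ'. Qed.

Lemma eq_confined v N N' E E' Q :
  N =i N' -> E =i E' -> confined v N E Q -> confined v N' E' Q.
Proof.
move=> eN eE [pos [[p1 p2 p3 p4 p5] vN pv H]]; exists pos; split=> //.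
- split.
  + by move=> x y; rewrite -!eN; exact: p1.
  + by move=> e; rewrite -!eN -eE; exact: p2.
  + by move=> e; rewrite -eE; exact: p3.
  + by move=> e f q; rewrite -!eE; exact: p4.
  + by move=> e w; rewrite -eE -eN; exact: p5.
- by rewrite -eN.
- move=> q [[w wN ->]|[e eE' qe]]; apply: H.
  + by left; exists w; rewrite ?eN.
  + by right; exists e; rewrite ?eE.
Qed.

Lemma grid_planar_signed_shift sx sy c N E pos :
  grid_planar N E pos -> grid_planar N E (signed_shift sx sy c \o pos).
Proof.
move=> [p1 p2 p3 p4 p5]; split=> //.
- by move=> x y xN yN /signed_shift_inj; exact: p1.
- move=> e /p3; rewrite /orthogonal_edge /= => -[] ->; by [left|right].
- move=> e f q eE fE ef; have [q' ->] := signed_shift_onto sx sy c q.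
  rewrite /on_edge /= !on_segment_signed_shift => qe qf.
  by have [w [? ? ->]] := p4 _ _ _ eE fE ef qe qf; exists w.
- by move=> e w eE wN; rewrite /on_edge /= on_segment_signed_shift; exact: p5.
Qed.

Lemma occupied_signed_shift sx sy c N E pos q :
  occupied N E (signed_shift sx sy c \o pos) (signed_shift sx sy c q) ->
  occupied N E pos q.
Proof.
move=> [[w wN /= /signed_shift_inj ->]|[e eE]]; first by left; exists w.
by rewrite /on_edge /= on_segment_signed_shift => ?; right; exists e.
Qed.

Lemma eq_grid_planar N E pos pos' : {in N, pos =1 pos'} ->
  grid_planar N E pos -> grid_planar N E pos'.
Proof.
move=> epos [p1 p2 p3 p4 p5].
have eon e q : e \in E -> on_edge pos' e q = on_edge pos e q.
  by move=> /p2[e1 e2]; rewrite /on_edge !epos.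
split=> //.
- by move=> x y xN yN; rewrite -!epos //; exact: p1.
- by move=> e eE; have [e1 e2] := p2 e eE; move: (p3 e eE);
    rewrite /orthogonal_edge !epos.
- move=> e f q eE fE ef; rewrite !eon // => qe qf.
  have [w [we wf ->]] := p4 _ _ _ eE fE ef qe qf; exists w; split=> //.
  by apply: epos; have [] := p2 _ eE; case/orP: we => /eqP->.
- by move=> e w eE wN; rewrite eon // -epos //; exact: p5.
Qed.

Lemma eq_occupied N E pos pos' q : {in N, pos =1 pos'} ->
  (forall e, e \in E -> e.1 \in N /\ e.2 \in N) ->
  occupied N E pos' q -> occupied N E pos q.
Proof.
move=> epos p2 [[w wN ->]|[e eE]]; first by left; exists w; rewrite ?epos.
by have [? ?] := p2 e eE; rewrite /on_edge -!epos // => ?; right; exists e.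
Qed.

(** By the last two hypotheses the new edge meets an old edge only at [pos v] or [pos s], and
    [grid_nodes] turns this into incidence. *)
Lemma grid_planar_attach v s N1 E1 N2 E2 pos :
  v \in N1 -> s \in N2 ->
  grid_planar N1 E1 pos -> grid_planar N2 E2 pos ->
  orthogonal_edge pos (v, s) ->
  (forall q, occupied N1 E1 pos q -> occupied N2 E2 pos q -> False) ->
  (forall q, on_edge pos (v, s) q -> occupied N1 E1 pos q -> q = pos v) ->
  (forall q, on_edge pos (v, s) q -> occupied N2 E2 pos q -> q = pos s) ->
  grid_planar (N1 ++ N2) ((v, s) :: E1 ++ E2) pos.
Proof.
move=> vN sN [p1 p2 p3 p4 p5] [r1 r2 r3 r4 r5] ovs dis m1 m2.
have occN1 w : w \in N1 -> occupied N1 E1 pos (pos w) by left; exists w.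
have occN2 w : w \in N2 -> occupied N2 E2 pos (pos w) by left; exists w.
have occE1 e q : e \in E1 -> on_edge pos e q -> occupied N1 E1 pos q.
  by right; exists e.
have occE2 e q : e \in E2 -> on_edge pos e q -> occupied N2 E2 pos q.
  by right; exists e.
have new1 e q : e \in E1 -> on_edge pos (v, s) q -> on_edge pos e q ->
    exists w, [/\ incident w (v, s), incident w e & q = pos w].
  move=> eE qn qe; have qv := m1 _ qn (occE1 _ _ eE qe).
  exists v; split=> //; first by rewrite /incident eqxx.
  by apply: p5 => //; rewrite -qv.
have new2 e q : e \in E2 -> on_edge pos (v, s) q -> on_edge pos e q ->
    exists w, [/\ incident w (v, s), incident w e & q = pos w].
  move=> eE qn qe; have qs := m2 _ qn (occE2 _ _ eE qe).
  exists s; split=> //; first by rewrite /incident eqxx orbT.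
  by apply: r5 => //; rewrite -qs.
split.
- move=> x y; rewrite !mem_cat => /orP[xN|xN] /orP[yN|yN] exy.
  + exact: p1.
  + by case: (dis (pos x)); [exact: occN1|rewrite exy; exact: occN2].
  + by case: (dis (pos x)); [rewrite exy; exact: occN1|exact: occN2].
  + exact: r1.
- move=> e; rewrite inE !mem_cat => /or3P[/eqP->|/p2[-> ->]|/r2[-> ->]] //=.
  + by rewrite vN sN orbT.
  + by rewrite !orbT.
- by move=> e; rewrite inE mem_cat => /or3P[/eqP->|/p3|/r3].
- move=> e f q; rewrite !inE !mem_cat.
  case/or3P=> [/eqP->|eE|eE]; case/or3P=> [/eqP->|fE|fE].
  + by rewrite eqxx.
  + by move=> _; exact: new1.
  + by move=> _; exact: new2.
  + by move=> _ qe qn; have [w [? ? ?]] := new1 _ _ eE qn qe; exists w.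
  + exact: p4.
  + by move=> _ /(occE1 _ _ eE) o1 /(occE2 _ _ fE) /(dis _ o1).
  + by move=> _ qe qn; have [w [? ? ?]] := new2 _ _ eE qn qe; exists w.
  + by move=> _ /(occE2 _ _ eE) o2 /(occE1 _ _ fE) o1; case: (dis _ o1 o2).
  + exact: r4.
- move=> e w; rewrite inE !mem_cat => /or3P[/eqP->|eE|eE] /orP[wN|wN] we.
  + by rewrite /incident (p1 _ _ wN vN (m1 _ we (occN1 _ wN))) eqxx.
  + by rewrite /incident (r1 _ _ wN sN (m2 _ we (occN2 _ wN))) eqxx orbT.
  + exact: p5.
  + by case: (dis (pos w)); [exact: occE1 eE we|exact: occN2].
  + by case: (dis (pos w)); [exact: occN1|exact: occE2 eE we].
  + exact: r5.
Qed.

Lemma confined_flip sx sy v N E Q : confined v N E Q ->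
  confined v N E (fun q => Q (signed_shift sx sy (0, 0) q)).
Proof.
move=> [pos [pl vN pv H]]; exists (signed_shift sx sy (0, 0) \o pos).
split=> //.
- exact: grid_planar_signed_shift.
- by rewrite /= pv /signed_shift /=; case: sx; case: sy.
- move=> q oq; apply: H.
  by apply: (@occupied_signed_shift sx sy (0, 0)); rewrite signed_shift0K.
Qed.

Lemma confined_attach c v s N1 E1 N2 E2 Q1 Q2 :
  confined v N1 E1 Q1 -> confined s N2 E2 Q2 ->
  (forall w, w \in N1 -> w \notin N2) ->
  c.1 = 0 \/ c.2 = 0 ->
  (forall q, Q1 q -> Q2 (q.1 - c.1, q.2 - c.2) -> False) ->
  (forall q, on_segment (0, 0) c q -> Q1 q -> q = (0, 0)) ->
  (forall q, on_segment (0, 0) c q -> Q2 (q.1 - c.1, q.2 - c.2) -> q = c) ->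
  confined v (N1 ++ N2) ((v, s) :: E1 ++ E2)
    (fun q => [\/ Q1 q, Q2 (q.1 - c.1, q.2 - c.2) | on_segment (0, 0) c q]).
Proof.
move=> [pos1 [pl1 vN pv H1]] [pos2 [pl2 sN ps H2]] dis c0 d12 m1 m2.
(* The second drawing is translated so that [s], drawn at the origin, lands on [c]. *)
pose pos w := if w \in N1 then pos1 w else signed_shift false false c (pos2 w).
have e1 : {in N1, pos1 =1 pos} by move=> w wN; rewrite /pos wN.
have e2 : {in N2, signed_shift false false c \o pos2 =1 pos}.
  by move=> w wN; rewrite /pos; case: ifP => // /dis; rewrite wN.
have pl1' := eq_grid_planar e1 pl1.
have pl2' := eq_grid_planar e2 (grid_planar_signed_shift false false c pl2).
have o1 q : occupied N1 E1 pos q -> Q1 q.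
  by move=> /(eq_occupied e1 (grid_ends pl1)) /H1.
have o2 q : occupied N2 E2 pos q -> Q2 (q.1 - c.1, q.2 - c.2).
  move=> /(eq_occupied e2 (grid_ends pl2)) oq; apply: H2.
  apply: (@occupied_signed_shift false false c).
  suff -> : signed_shift false false c (q.1 - c.1, q.2 - c.2) = q by [].
  by case: q {oq} => a b; rewrite /signed_shift /= !subrK.
have posv : pos v = (0, 0) by rewrite -e1.
have poss : pos s = c.
  by rewrite -e2 //= ps /signed_shift /= !add0r; case: (c).
exists pos; split=> //.
- apply: grid_planar_attach => //.
  + by rewrite /orthogonal_edge /= posv poss; case: c0; [right|left].
  + by move=> q /o1 /d12 + /o2.
  + by move=> q; rewrite /on_edge /= posv poss => /m1 + /o1; exact.
  + by move=> q; rewrite /on_edge /= posv poss => /m2 + /o2; exact.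
- by rewrite mem_cat vN.
- move=> q [[w]|[e]]; rewrite ?inE mem_cat.
  + case/orP=> wN ->; [apply: Or31; apply: o1|apply: Or32; apply: o2];
      by left; exists w.
  + case/or3P=> [/eqP->|eE|eE] qe.
    * by apply: Or33; move: qe; rewrite /on_edge /= posv poss.
    * by apply: Or31; apply: o1; right; exists e.
    * by apply: Or32; apply: o2; right; exists e.
Qed.

Lemma confined_point v : confined v [:: v] [::] (fun q => q = (0, 0)).
Proof.
exists (fun=> (0, 0)); split; rewrite ?inE //.
- by split=> // x y; rewrite !inE => /eqP-> /eqP->.
- by move=> q [[w _ ->]|[e]].
Qed.

End GridDrawings.

(** * Spine drawings *)

(** [Leaf] is the empty tree that stands for a missing child, not a node without children. *)
Inductive ttree (V : Type) : Type :=
  | Leaf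
  | Node of V & ttree V & ttree V & ttree V.
Arguments Leaf {V}.

Section TreeDrawings.
Variable V : finType.
Implicit Types (v w : V) (t h x y : ttree V) (Q : int * int -> Prop).
Implicit Types (N : seq V) (E : seq (V * V)) (a b d k u : nat).

Fixpoint nodes t : seq V :=
  if t is Node v h x y then v :: nodes h ++ nodes x ++ nodes y else [::].

Definition link v t : seq (V * V) :=
  if t is Node w _ _ _ then [:: (v, w)] else [::].

Fixpoint edges t : seq (V * V) :=
  if t is Node v h x y then
    (link v h ++ edges h) ++ (link v x ++ edges x) ++ (link v y ++ edges y)
  else [::].

Definition tree_size t : nat := size (nodes t).

Lemma tree_size_node v h x y :
  tree_size (Node v h x y) = (tree_size h + tree_size x + tree_size y).+1.
Proof. by rewrite /tree_size /= !size_cat addnA. Qed.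

(** The box spans [a + b + 1] columns, so [a + b < tree_size t] means at most as many columns as
    nodes. *)
Definition box a b u d (q : int * int) : Prop :=
  - a%:Z <= q.1 <= b%:Z /\ - u%:Z <= q.2 <= d%:Z.

(* The root sits at the origin, where its parent can reach it from the left;
   [u] and [d] bound the number of rows above and below it (the second
   coordinate grows downwards). *)
Definition side_drawable u d t : Prop :=
  if t is Node v _ _ _ then
    exists a b, (a + b < tree_size t)%N /\
      confined v (nodes t) (edges t)
        (fun q => box a b u d q /\ (q.2 = 0 -> 0 <= q.1))
  else True.

(* The root is at the origin, reachable from above, and there are at most [k]
   rows in total. *)
Definition top_drawable k t : Prop :=
  if t is Node v _ _ _ then
    exists a b u d, [/\ (a + b < tree_size t)%N, (u + d < k)%N &
      confined v (nodes t) (edges t)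
        (fun q => box a b u d q /\ (q.1 = 0 -> 0 <= q.2))]
  else True.

Lemma top_drawableW k k' t : (k <= k')%N ->
  top_drawable k t -> top_drawable k' t.
Proof.
case: t => // v h x y kk [a [b [u [d [ab ud cf]]]]]; exists a, b, u, d.
by split=> //; exact: leq_trans ud kk.
Qed.

(** Since the old drawing stops at row 0, [t] may reuse its columns. The root of [t] goes to row
    [u1 + 1], which places the top row of [t] at row 1, and the edge down column 0 is free because
    that root is reachable from above. *)
Lemma attach_below v N E a b u k t :
  confined v N E (fun q => box a b u 0 q /\ (q.2 = 0 -> q.1 = 0)) ->
  top_drawable k t -> (forall w, w \in N -> w \notin nodes t) ->
  exists a' b', (a' + b' <= a + b + tree_size t)%N /\
    confined v (N ++ nodes t) (E ++ link v t ++ edges t)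
      (fun q => box a' b' u k q /\ (q.2 = 0 -> q.1 = 0)).
Proof.
move=> cfN; case: t => [_ _|s h x y].
  exists a, b; rewrite /= !cats0 addn0; split=> //.
  by apply: confinedW cfN => q; rewrite /box => -[[? ?] ?];
    do 2?split=> //; lia.
set t := Node s h x y => -[a1 [b1 [u1 [d1 [ab ud cft]]]]] dis.
exists (maxn a a1), (maxn b b1); split; first by lia.
have := confined_attach (c := (0, u1.+1%:Z)) cfN cft dis (or_introl erefl).
move=> cf; apply: eq_confined (confinedW _ (cf _ _ _)) => //.
- by move=> e; rewrite !(mem_cat, inE); case: (e == _); rewrite ?orbT.
- rewrite /on_segment /between /box => -[q1 q2] /=.
  by case=> [[[? ?] ?]|[[? ?] ?]|/andP[? ?]]; do 2?split; lia.
- by rewrite /box => -[q1 q2] /= [[? ?] ?] [[? ?] ?]; lia.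
- rewrite /on_segment /between /box => -[q1 q2] /= /andP[? ?] [[? ?] ?].
  by congr pair; lia.
- rewrite /on_segment /between /box => -[q1 q2] /= /andP[? ?] [[? ?] ?].
  by congr pair; lia.
Qed.

Lemma attach_above v N E a b d k t :
  confined v N E (fun q => box a b 0 d q /\ (q.2 = 0 -> q.1 = 0)) ->
  top_drawable k t -> (forall w, w \in N -> w \notin nodes t) ->
  exists a' b', (a' + b' <= a + b + tree_size t)%N /\
    confined v (N ++ nodes t) (E ++ link v t ++ edges t)
      (fun q => box a' b' k d q /\ (q.2 = 0 -> q.1 = 0)).
Proof.
move=> /(confined_flip false true) cf tk dis.
have [|a' [b' [ab cf']]] := @attach_below v N E a b d k t _ tk dis.
  apply: confinedW cf => -[q1 q2]; rewrite /box /signed_shift /= => -[[? ?] ?].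
  by do 2?split; lia.
exists a', b'; split=> //; apply: confinedW (confined_flip false true cf').
move=> -[q1 q2]; rewrite /box /signed_shift /= => -[[? ?] ?].
by do 2?split; lia.
Qed.

(** Here [t] shares the rows of the old drawing and starts in the fresh column [b + 1]. The
    conclusion keeps [Q] because a box alone forgets which part of row 0 or column 0 is still
    free. *)
Lemma attach_right v N E Q a b u d t :
  confined v N E Q ->
  (forall q, Q q -> box a b u d q /\ (q.2 = 0 -> q.1 <= 0)) ->
  side_drawable u d t -> (forall w, w \in N -> w \notin nodes t) ->
  exists b', (b' <= b + tree_size t)%N /\
    confined v (N ++ nodes t) (E ++ link v t ++ edges t)
      (fun q => box a b' u d q /\ [\/ Q q, b%:Z < q.1 | q.2 = 0 /\ 0 <= q.1]).
Proof.
move=> cfN QP; case: t => [_ _|s h x y].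
  exists b; rewrite /= !cats0 addn0; split=> //.
  by apply: confinedW cfN => q Qq; split; [case: (QP q Qq)|apply: Or31].
set t := Node s h x y => -[a1 [b1 [ab cft]]] dis.
exists (b + 1 + a1 + b1)%N; split; first by lia.
have := confined_attach (c := ((b + 1 + a1)%:Z, 0)) cfN cft dis
  (or_intror erefl).
move=> cf; apply: eq_confined (confinedW _ (cf _ _ _)) => //.
- by move=> e; rewrite !(mem_cat, inE); case: (e == _); rewrite ?orbT.
- move=> [q1 q2]; rewrite {1}/box /= => -[Qq|[[? ?] ?]|].
  + split; last exact: Or31.
    by have [] := QP _ Qq; rewrite /box /= => -[? ?] ?; split; lia.
  + by rewrite /box /=; split; [split; lia|apply: Or32; lia].
  + rewrite /on_segment /between /box /= => /andP[? ?].
    by split; [split; lia|apply: Or33; lia].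
- move=> -[q1 q2] /QP; rewrite /box /= => -[[? ?] ?] [[? ?] ?]; lia.
- rewrite /on_segment /between => -[q1 q2] /= /andP[? ?] /QP.
  by rewrite /box /= => -[[? ?] ?]; congr pair; lia.
- rewrite /on_segment /between /box => -[q1 q2] /= /andP[? ?] [[? ?] ?].
  by congr pair; lia.
Qed.

Lemma attach_left v N E Q a b u d t :
  confined v N E Q ->
  (forall q, Q q -> box a b u d q /\ (q.2 = 0 -> 0 <= q.1)) ->
  side_drawable u d t -> (forall w, w \in N -> w \notin nodes t) ->
  exists a', (a' <= a + tree_size t)%N /\
    confined v (N ++ nodes t) (E ++ link v t ++ edges t)
      (fun q => box a' b u d q /\ [\/ Q q, q.1 < - a%:Z | q.2 = 0 /\ q.1 <= 0]).
Proof.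
move=> /(confined_flip true false) cf QP ts dis.
have [|a' [aa cf']] := @attach_right v N E _ b a u d t cf _ ts dis.
  move=> -[q1 q2] /QP; rewrite /box /signed_shift /= => -[[? ?] ?].
  by do 2?split; lia.
exists a'; split=> //; apply: confinedW (confined_flip true false cf').
move=> -[q1 q2]; rewrite /box /signed_shift /= => -[[? ?] H].
split; first by split; lia.
case: H => [H|?|?]; last 2 first.
- by apply: Or32; lia.
- by apply: Or33; lia.
by apply: Or31; move: H; rewrite !addr0 opprK.
Qed.

(** The path continues to the right into [p], with [s] hanging below the root and [r] above it; row
    0 to the left of the root stays empty. *)
Lemma side_drawable_node u d v p s r :
  uniq (nodes (Node v p s r)) ->
  side_drawable u d p -> top_drawable d s -> top_drawable u r ->
  side_drawable u d (Node v p s r).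
Proof.
rewrite /= !cat_uniq !mem_cat !negb_or -!all_predC.
move=> /andP[/and3P[vp vs vr]]; rewrite all_cat.
move=> /and5P[Up /andP[/allP sp /allP rp] Us /allP rs Ur] Dp Ds Dr.
have cf0 : confined v [:: v] [::]
    (fun q => box 0 0 0 0 q /\ (q.2 = 0 -> q.1 = 0)).
  by apply: confinedW (confined_point v) => q ->; rewrite /box /=; do 2?split.
have [|a1 [b1 [ab1 cf1]]] := attach_below cf0 Ds.
  by move=> w; rewrite inE => /eqP->.
have [|a2 [b2 [ab2 cf2]]] := attach_above cf1 Dr.
  move=> w; rewrite mem_cat inE => /orP[/eqP->//|ws].
  by apply/negP => /rs /=; rewrite ws.
have [||b3 [ab3 cf3]] := attach_right (a := a2) (b := b2) cf2 _ Dp.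
- by move=> q; rewrite /box => -[[? ?] ?]; do 2?split; lia.
- move=> w; rewrite !mem_cat inE => /orP[/orP[/eqP->//|ws]|wr].
    by apply/negP => wp; have := sp _ ws; rewrite /= wp.
  by apply/negP => wp; have := rp _ wr; rewrite /= wp.
exists a2, b3; split; first by rewrite tree_size_node; lia.
apply: eq_confined (confinedW _ cf3).
- by move=> w; rewrite /= !(mem_cat, inE); do !case: (_ \in _); rewrite ?orbT.
- by move=> e; rewrite /= !(mem_cat, inE); do !case: (_ \in _); rewrite ?orbT.
- by move=> q [bq []]; rewrite /box in bq *;
    [case=> ? ?|move=> ?|move=> ?]; split=> //; lia.
Qed.

(** The path passes through the root, to [p] on the right and [s] on the left. As [r] hangs below,
    column 0 above the root stays empty. *)
Lemma top_drawable_node u d k v p s r :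
  uniq (nodes (Node v p s r)) -> (u + d < k)%N ->
  side_drawable u d p -> side_drawable u d s -> top_drawable d r ->
  top_drawable k (Node v p s r).
Proof.
rewrite /= !cat_uniq !mem_cat !negb_or -!all_predC.
move=> /andP[/and3P[vp vs vr]]; rewrite all_cat.
move=> /and5P[Up /andP[/allP sp /allP rp] Us /allP rs Ur] udk Dp Ds Dr.
have cf0 : confined v [:: v] [::]
    (fun q => box 0 0 0 0 q /\ (q.2 = 0 -> q.1 = 0)).
  by apply: confinedW (confined_point v) => q ->; rewrite /box /=; do 2?split.
have [|a1 [b1 [ab1 cf1]]] := attach_below cf0 Dr.
  by move=> w; rewrite inE => /eqP->.
have [||b2 [ab2 cf2]] :=
    attach_right (a := a1) (b := b1) (u := u) (d := d) cf1 _ Dp.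
- by move=> q; rewrite /box => -[[? ?] ?]; do 2?split; lia.
- move=> w; rewrite mem_cat inE => /orP[/eqP->//|wr].
  by apply/negP => wp; have := rp _ wr; rewrite /= wp.
have [||a3 [ab3 cf3]] :=
    attach_left (a := a1) (b := b2) (u := u) (d := d) cf2 _ Ds.
- by move=> q [bq []]; rewrite /box in bq *;
    [case=> ? ?|move=> ?|move=> ?]; split=> //; lia.
- move=> w; rewrite !mem_cat inE => /orP[/orP[/eqP->//|wr]|wp].
    by apply/negP => ws; have := rs _ wr; rewrite /= ws.
  by apply/negP => ws; have := sp _ ws; rewrite /= wp.
exists a3, b2, u, d; split=> //; first by rewrite tree_size_node; lia.
apply: eq_confined (confinedW _ cf3).
- by move=> w; rewrite /= !(mem_cat, inE); do !case: (_ \in _); rewrite ?orbT.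
- by move=> e; rewrite /= !(mem_cat, inE); do !case: (_ \in _); rewrite ?orbT.
- move=> q [bq H]; split=> // q10; rewrite /box in H.
  case: H => [[_ []]|?|?]; [case=> -[? ?] ?|move=> ?|move=> ?| |]; lia.
Qed.

(** A drawing depends on the children only through membership in [nodes] and [edges], so their roles
    can be exchanged. *)
Lemma side_drawable_swap u d v p s r :
  side_drawable u d (Node v s p r) -> side_drawable u d (Node v p s r).
Proof.
rewrite /side_drawable !tree_size_node (addnC (tree_size p)).
move=> [a [b [ab cf]]].
exists a, b; split=> //; apply: eq_confined cf.
- by move=> w; rewrite /= !(mem_cat, inE); do !case: (_ \in _); rewrite ?orbT.
- by move=> e; rewrite /= !(mem_cat, inE); do !case: (_ \in _); rewrite ?orbT.
Qed.

Lemma top_drawable_rot k v p s r :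
  top_drawable k (Node v s r p) -> top_drawable k (Node v p s r).
Proof.
rewrite /top_drawable !tree_size_node.
rewrite -(addnA (tree_size p)) (addnC (tree_size p)).
move=> [a [b [u [d [ab ud cf]]]]].
exists a, b, u, d; split=> //; apply: eq_confined cf.
- by move=> w; rewrite /= !(mem_cat, inE); do !case: (_ \in _); rewrite ?orbT.
- by move=> e; rewrite /= !(mem_cat, inE); do !case: (_ \in _); rewrite ?orbT.
Qed.

End TreeDrawings.

(** * Heavy paths *)

Section HeavyPaths.
Variable V : finType.
Implicit Types (v w : V) (t s h x y : ttree V) (d k m n u : nat).

Fixpoint heavy_first t : bool :=
  if t is Node _ h x y then
    [&& (tree_size y <= tree_size x)%N, (tree_size x <= tree_size h)%N,
        heavy_first h, heavy_first x & heavy_first y]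
  else true.

Definition well_formed t : bool := uniq (nodes t) && heavy_first t.

Lemma well_formed_node v h x y : well_formed (Node v h x y) ->
  [/\ well_formed h, well_formed x & well_formed y] /\
  (tree_size y <= tree_size x <= tree_size h)%N.
Proof.
rewrite /well_formed /= !cat_uniq.
move=> /andP[/and4P[_ uh _ /and3P[ux _ uy]] /and5P[-> -> -> -> ->]].
by rewrite uh ux uy.
Qed.

(* X and Y of the introduction. *)
Fixpoint major t : nat :=
  if t is Node _ h x y then maxn (tree_size x) (major h) else 0.

Fixpoint minor t : nat :=
  if t is Node _ h x y then maxn (tree_size y) (minor h) else 0.

Inductive on_heavy_path s : ttree V -> Prop :=
  | on_heavy_path_root : on_heavy_path s s
  | on_heavy_path_step v h x y :
      on_heavy_path s h -> on_heavy_path s (Node v h x y).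

Lemma on_heavy_path_well_formed s t :
  on_heavy_path s t -> well_formed t -> well_formed s.
Proof. by elim=> // v h x y _ IH /well_formed_node[[/IH]]. Qed.

Lemma on_heavy_path_size s t :
  on_heavy_path s t -> (tree_size s <= tree_size t)%N.
Proof. by elim=> // v h x y _; rewrite tree_size_node; lia. Qed.

Lemma major_minor_size t : well_formed t ->
  (2 * major t <= tree_size t)%N /\ (3 * minor t <= tree_size t)%N.
Proof.
elim: t => //= v h IHh x _ y _ /well_formed_node[[/IHh[? ?] _ _] ?].
by rewrite tree_size_node; split; lia.
Qed.

(** If the root attains the second-child maximum, it is the node sought. If it attains only the
    third-child maximum, then [2 * major h] is at most the size of [h] and [2 * tree_size y] at most
    that of [x] and [y] together. Otherwise both maxima come from [h]. *)
Lemma heavy_path_trichotomy t : well_formed t ->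
  (2 * (major t + minor t) <= tree_size t)%N \/
  exists v h x y, [/\ on_heavy_path (Node v h x y) t, major t = tree_size x &
    minor t = tree_size y \/ (3 * minor t <= tree_size h)%N].
Proof.
elim: t => [|v h IHh x _ y _]; first by left.
move=> /well_formed_node[[wh _ _] xy]; have [Mh mh] := major_minor_size wh.
rewrite tree_size_node /=.
have [xM|Mx] := leqP (tree_size x) (major h); last first.
  right; exists v, h, x, y; split; first exact: on_heavy_path_root.
    by [].
  by have [ym|my] := leqP (tree_size y) (minor h); [right|left].
have [ym|my] := leqP (tree_size y) (minor h); last by left; lia.
have [?|[v' [h' [x' [y' [hp ? ?]]]]]] := IHh wh; first by left; lia.
by right; exists v', h', x', y'; split=> //; exact: on_heavy_path_step.
Qed.

(** * Row counts in terms of a height bound [g] for smaller subtrees *)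

Section SubtreeBound.
Variables (g : nat -> nat) (n : nat).
Hypothesis g_mono : {homo g : m k / (m <= k)%N}.
Hypothesis g_drawable : forall s, well_formed s -> (tree_size s < n)%N ->
  top_drawable (g (tree_size s)) s.

Let top_drawable_le k s : well_formed s -> (tree_size s < n)%N ->
  (g (tree_size s) <= k)%N -> top_drawable k s.
Proof. by move=> ws sn gk; apply: top_drawableW gk _; exact: g_drawable. Qed.

(** The path follows the heavy children, with second children below and third children above. Only
    proper subtrees are drawn by hypothesis, so size [n] itself is allowed. *)
Lemma side_drawable_heavy u d t : well_formed t -> (tree_size t <= n)%N ->
  (g (minor t) <= u)%N -> (g (major t) <= d)%N -> side_drawable u d t.
Proof.
elim: t => // v h IHh x _ y _ wt; have [[wh wx wy] ?] := well_formed_node wt.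
rewrite tree_size_node /= => tn gu gd.
apply: side_drawable_node.
- by case/andP: wt.
- apply: IHh => //; first by lia.
  + by apply: leq_trans gu; apply: g_mono; lia.
  + by apply: leq_trans gd; apply: g_mono; lia.
- apply: top_drawable_le => //; first by lia.
  by apply: leq_trans gd; apply: g_mono; lia.
- apply: top_drawable_le => //; first by lia.
  by apply: leq_trans gu; apply: g_mono; lia.
Qed.

Lemma top_drawable_heavy v h x y :
  let t := Node v h x y in well_formed t -> (tree_size t <= n)%N ->
  top_drawable (g (maxn (minor h) (minor x)) +
    g (maxn (tree_size y) (maxn (major h) (major x)))).+1 t.
Proof.
move=> t wt; have [[wh wx wy] ?] := well_formed_node wt.
rewrite tree_size_node => tn.
apply: (top_drawable_node _ (ltnSn _)).
- by case/andP: wt.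
- by apply: side_drawable_heavy => //; [lia| |]; apply: g_mono; lia.
- by apply: side_drawable_heavy => //; [lia| |]; apply: g_mono; lia.
- by apply: top_drawable_le => //; [lia|]; apply: g_mono; lia.
Qed.

(* The path leaves the heavy path at the parent of [s], so that [s] hangs from
   it; the third children, whose sizes are at most
   [(tree_size t - tree_size s)./2], are on the side opposite to [s]. *)
Lemma hang_heavy_subtree s t u d : on_heavy_path s t -> s <> t ->
  well_formed t -> (tree_size t <= n)%N ->
  (g (tree_size t - tree_size s)./2 <= u)%N ->
  (g (tree_size t - tree_size s) <= d)%N ->
  top_drawable d s ->
  side_drawable u d t /\ forall k, (u + d < k)%N -> top_drawable k t.
Proof.
move=> + + + + + + Ds; elim=> // v h x y hp IH _ wt.
have [[wh wx wy] ?] := well_formed_node wt.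
have sh := on_heavy_path_size hp.
rewrite tree_size_node => tn gu gd.
have [? ?] := major_minor_size wx; have [? ?] := major_minor_size wy.
have Sx : side_drawable u d x.
  apply: side_drawable_heavy => //; first by lia.
  + by apply: leq_trans gu; apply: g_mono; lia.
  + by apply: leq_trans gd; apply: g_mono; lia.
have Sy : side_drawable u d y.
  apply: side_drawable_heavy => //; first by lia.
  + by apply: leq_trans gu; apply: g_mono; lia.
  + by apply: leq_trans gd; apply: g_mono; lia.
have Ly : top_drawable u y.
  apply: top_drawable_le => //; first by lia.
  by apply: leq_trans gu; apply: g_mono; lia.
have Lx : top_drawable d x.
  apply: top_drawable_le => //; first by lia.
  by apply: leq_trans gd; apply: g_mono; lia.
(* The subtree [y] hangs above in a side drawing but below in a top drawing, hence the two
   bounds. *)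
have Ly' : top_drawable d y.
  apply: top_drawable_le => //; first by lia.
  by apply: leq_trans gd; apply: g_mono; lia.
have Ut : uniq (nodes (Node v h x y)) by case/andP: wt.
(* At the parent of [s] the path turns into [x], or runs through [x] and [y] in a top drawing, and
   [s] hangs below. *)
have [sh_eq|sh_neq] := pselect (s = h).
  subst s; split.
    apply: side_drawable_swap; apply: side_drawable_node => //.
    by move: Ut; rewrite /= uniq_catCA !mem_cat orbCA.
  move=> k udk; apply: top_drawable_rot; apply: (top_drawable_node _ udk) => //.
  by move: Ut; rewrite /= uniq_catC -catA !mem_cat orbC -orbA.
have [|||Sh _] := IH sh_neq wh; first by lia.
- by apply: leq_trans gu; apply: g_mono; lia.
- by apply: leq_trans gd; apply: g_mono; lia.
split; first exact: side_drawable_node.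
by move=> k udk; exact: top_drawable_node udk _ _ _.
Qed.

(** By [major_minor_size], third children along the two heavy paths are at most a third, and second
    children at most half, of [h] or of [x], which is no larger. *)
Lemma top_drawable_thirds v h x y :
  let t := Node v h x y in well_formed t -> (tree_size t <= n)%N ->
  top_drawable
    (g (tree_size h %/ 3) + g (maxn (tree_size y) (tree_size h)./2)).+1 t.
Proof.
move=> t wt tn; have [[wh wx wy] ?] := well_formed_node wt.
have [? ?] := major_minor_size wh; have [? ?] := major_minor_size wx.
apply: top_drawableW (top_drawable_heavy wt tn); rewrite ltnS.
by apply: leq_add; apply: g_mono; lia.
Qed.

End SubtreeBound.
End HeavyPaths.

(** * The exponent 4/7 *)

Section Exponent.
Variable R : realType.
Implicit Types (r s t A B h x y e : R).

(* AM-GM: for the least admissible [A] and [B] the right-hand side is the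
   tangent line at [r = t ^ 7]. *)
Lemma powR47_tangent r t A B : 0 <= r -> 0 < t ->
  3 * t ^+ 4 <= 7 * A -> 4 <= 7 * B * t ^+ 3 -> r `^ (4 / 7) <= A + B * r.
Proof.
move=> r0 t0 hA hB; set z := r `^ 7^-1.
have z0 : 0 <= z by exact: powR_ge0.
have zr : z ^+ 7 = r by rewrite -powR_mulrn // -powRrM mulVf ?powRr1.
have -> : r `^ (4 / 7) = z ^+ 4 by rewrite -powR_mulrn // -powRrM mulrC.
suff H : 7 * z ^+ 4 * t ^+ 3 <= 3 * t ^+ 4 * t ^+ 3 + 4 * z ^+ 7.
  have t3 : 0 < t ^+ 3 by exact: exprn_gt0.
  rewrite -(ler_pM2r (_ : 0 < 7 * t ^+ 3)); last by rewrite mulr_gt0.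
  rewrite -zr; have z7 : 0 <= z ^+ 7 by exact: exprn_ge0.
  have := ler_wpM2r (ltW t3) hA; have := ler_wpM2r z7 hB; lra.
rewrite -subr_ge0.
(* Tangency makes [z = t] a double root, and the cofactor has nonnegative coefficients. *)
have -> : 3 * t ^+ 4 * t ^+ 3 + 4 * z ^+ 7 - 7 * z ^+ 4 * t ^+ 3 =
   (z - t) ^+ 2 * (4 * z ^+ 5 + 8 * z ^+ 4 * t + 12 * z ^+ 3 * t ^+ 2 +
     9 * z ^+ 2 * t ^+ 3 + 6 * z * t ^+ 4 + 3 * t ^+ 5) by ring.
have t0' := ltW t0.
by rewrite mulr_ge0 ?sqr_ge0 // !addr_ge0 // !mulr_ge0 // ?exprn_ge0.
Qed.

Local Notation f r := (r `^ (4 / 7)).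

(* [tangentN] is close to the tangent line at [N / 1000]. *)
Lemma tangent015 r : 0 <= r -> f r <= 40 / 1000 + 3435 / 1000 * r.
Proof. by move=> r0; apply: (@powR47_tangent _ (55 / 100)); lra. Qed.

Lemma tangent040 r : 0 <= r -> f r <= 68 / 1000 + 2286 / 1000 * r.
Proof. by move=> r0; apply: (@powR47_tangent _ (63 / 100)); lra. Qed.

Lemma tangent070 r : 0 <= r -> f r <= 92 / 1000 + 1818 / 1000 * r.
Proof. by move=> r0; apply: (@powR47_tangent _ (68 / 100)); lra. Qed.

Lemma tangent096 r : 0 <= r -> f r <= 116 / 1000 + 1531 / 1000 * r.
Proof. by move=> r0; apply: (@powR47_tangent _ (72 / 100)); lra. Qed.

Lemma tangent120 r : 0 <= r -> f r <= 129 / 1000 + 1411 / 1000 * r.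
Proof. by move=> r0; apply: (@powR47_tangent _ (74 / 100)); lra. Qed.

Lemma tangent175 r : 0 <= r -> f r <= 159 / 1000 + 1205 / 1000 * r.
Proof. by move=> r0; apply: (@powR47_tangent _ (78 / 100)); lra. Qed.

Lemma tangent190 r : 0 <= r -> f r <= 167 / 1000 + 1159 / 1000 * r.
Proof. by move=> r0; apply: (@powR47_tangent _ (79 / 100)); lra. Qed.

Lemma tangent250 r : 0 <= r -> f r <= 194 / 1000 + 1037 / 1000 * r.
Proof. by move=> r0; apply: (@powR47_tangent _ (82 / 100)); lra. Qed.

Lemma tangent287 r : 0 <= r -> f r <= 214 / 1000 + 965 / 1000 * r.
Proof. by move=> r0; apply: (@powR47_tangent _ (84 / 100)); lra. Qed.

Lemma tangent400 r : 0 <= r -> f r <= 258 / 1000 + 839 / 1000 * r.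
Proof. by move=> r0; apply: (@powR47_tangent _ (88 / 100)); lra. Qed.


(** By concavity the extreme case is [r = s = 1/4], so a single tangent suffices. *)
Lemma halves_bound r s : 0 <= r -> 0 <= s -> 2 * (r + s) <= 1 ->
  f r + f s <= 98 / 100.
Proof.
move=> r0 s0 rs; have := tangent250 r0; have := tangent250 s0; lra.
Qed.

(** Used when [minor] is the third child of [s]: [h], [x], [y] are the shares of its children and
    [e] is the share outside [s]. The last hypothesis forces [x + y > 0.572], which leaves little
    for [h + e]. *)
Lemma balanced_bound h x y e : 0 <= y -> y <= x -> x <= h -> 0 <= e ->
  h + x + y + e <= 1 -> 98 / 100 < f x + f y ->
  [/\ e <= y, f (e / 2) + f y + f (h / 3) <= 98 / 100 &
      f (e / 2) + f (h / 2) + f (h / 3) <= 98 / 100].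
Proof.
move=> y0 yx xh e0 sum fxy.
have x0 : 0 <= x by lra.
have h2 : 0 <= h / 2 by lra.
have h3 : 0 <= h / 3 by lra.
have e2 : 0 <= e / 2 by lra.
have Tx := tangent287 x0; have Ty := tangent287 y0.
split.
- lra.
- have := tangent070 e2; have := tangent096 h3; lra.
- have := tangent040 e2; have := tangent175 h2; have := tangent120 h3; lra.
Qed.

Lemma two_heavy_bound h x y e : 0 <= y -> 0 <= x -> x <= h -> 0 <= e ->
  h + x + y + e <= 1 -> 98 / 100 < f x + f (h / 3) ->
  [/\ 2 * e <= h, f (e / 2) + f y + f (h / 3) <= 98 / 100 &
      f (e / 2) + f (h / 2) + f (h / 3) <= 98 / 100].
Proof.
move=> y0 x0 xh e0 sum fxh.
have h2 : 0 <= h / 2 by lra.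
have h3 : 0 <= h / 3 by lra.
have e2 : 0 <= e / 2 by lra.
have Tx := tangent400 x0; have Th := tangent190 h3.
split.
- lra.
- have := tangent040 e2; have := tangent070 y0; lra.
- have := tangent015 e2; have := tangent287 h2; lra.
Qed.

End Exponent.

(** * The induction on the size of the tree *)

Section HeightBound.
Variable R : realType.
Implicit Types (a b c m n : nat).

Definition row_bound n : nat := Num.truncn (100 * n%:R `^ (4 / 7) : R).

Lemma row_bound_le n : (row_bound n)%:R <= 100 * n%:R `^ (4 / 7) :> R.
Proof. by rewrite /row_bound truncn_le // mulr_ge0 ?powR_ge0. Qed.

Lemma row_bound_mono : {homo row_bound : m n / (m <= n)%N}.
Proof.
move=> m n mn; apply: le_truncn; rewrite ler_pM2l //.
by rewrite ge0_ler_powR ?nnegrE ?ler_nat.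
Qed.

Definition share n m : R := m%:R / n%:R.

Lemma share_ge0 n m : 0 <= share n m.
Proof. by rewrite divr_ge0. Qed.

Lemma le_powR47 (r s : R) : 0 <= r -> r <= s -> r `^ (4 / 7) <= s `^ (4 / 7).
Proof. by move=> r0 rs; rewrite ge0_ler_powR ?nnegrE // (le_trans r0). Qed.

(** The 2 percent missing from [100 * P] amount to at least 2 since [P >= 1]; this is what the
    factor 100 in [row_bound] is for. *)
Lemma row_bound_add3 n a b c : (0 < n)%N ->
  share n a `^ (4 / 7) + share n b `^ (4 / 7) + share n c `^ (4 / 7)
    <= 98 / 100 ->
  (row_bound a + row_bound b + row_bound c + 2 <= row_bound n)%N.
Proof.
move=> n0 le98; have n0' : (0 : R) < n%:R by rewrite ltr0n.
set P : R := n%:R `^ (4 / 7).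
have P1 : 1 <= P.
  have <- : 1 `^ (4 / 7) = 1 :> R by rewrite powR1.
  by rewrite le_powR47 // ler1n.
have H m : (row_bound m)%:R <= 100 * P * share n m `^ (4 / 7).
  rewrite -mulrA -powRM ?share_ge0 //.
  have -> : n%:R * share n m = m%:R by rewrite /share mulrC divfK ?gt_eqF.
  exact: row_bound_le.
rewrite /row_bound truncn_ge_nat ?mulr_ge0 ?powR_ge0 // !natrD.
have := H a; have := H b; have := H c; rewrite -/P.
have : 100 * P * (share n a `^ (4 / 7) + share n b `^ (4 / 7) +
   share n c `^ (4 / 7)) <= 100 * P * (98 / 100) by rewrite ler_pM2l //; lra.
rewrite !mulrDr; lra.
Qed.

Lemma row_bound_add2 n a b : (0 < n)%N ->
  share n a `^ (4 / 7) + share n b `^ (4 / 7) <= 98 / 100 ->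
  (row_bound a + row_bound b < row_bound n)%N.
Proof.
move=> n0 le98; have := @row_bound_add3 n a b 0 n0.
(* The third summand vanishes because the exponent is nonzero; [0] to the power [0] would be [1]. *)
rewrite {3}/share mul0r powR0 ?addr0; last by apply/eqP; lra.
by move=> /(_ le98); lia.
Qed.

Variable V : finType.

Lemma top_drawable_row_bound (t : ttree V) :
  well_formed t -> top_drawable (row_bound (tree_size t)) t.
Proof.
have [n tn] := ubnP (tree_size t).
elim: n t tn => // n IH [|v h0 x0 y0] // tn wt.
have mono := row_bound_mono.
have {}IH (s : ttree V) : well_formed s ->
    (tree_size s < tree_size (Node v h0 x0 y0))%N ->
    top_drawable (row_bound (tree_size s)) s.
  by move=> ws st; apply: (IH s _ ws); exact: leq_trans st _.
have [[wh0 wx0 wy0] size0] := well_formed_node wt.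
have tE := tree_size_node v h0 x0 y0.
set t := Node v h0 x0 y0 in tn IH wt tE *.
set N := tree_size t in IH tE *.
have N0 : (0 < N)%N by rewrite tE.
have half_mul a : (2 * a./2 <= a)%N by lia.
have third_mul a : (3 * (a %/ 3) <= a)%N by lia.
have sum_lt i j k m : (i + j + k + 2 <= m -> i + (k + j).+1 < m)%N by lia.
have half_le a b : (2 * a <= b)%N -> (a <= b./2)%N by lia.
have share_le a b : (a <= b)%N -> share N a <= share N b.
  by move=> ab; rewrite ler_pM2r ?invr_gt0 ?ltr0n // ler_nat.
have shareD a b : share N (a + b) = share N a + share N b.
  by rewrite /share natrD mulrDl.
have shareM a b : share N (a * b) = a%:R * share N b.
  by rewrite /share natrM mulrA.
have share1 : share N N = 1 by rewrite /share divff // pnatr_eq0 -lt0n.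
have share0 := share_ge0 N.
pose X := maxn (tree_size y0) (maxn (major h0) (major x0)).
pose Y := maxn (minor h0) (minor x0).
(* The path through the two largest children of the root suffices in the first case. *)
have [XYle|XYgt] :=
    leP (share N Y `^ (4 / 7) + share N X `^ (4 / 7)) (98 / 100 : R).
  apply: top_drawableW (top_drawable_heavy mono IH wt (leqnn _)).
  exact: row_bound_add2.
have XYbig : (N < 2 * (X + Y))%N.
  rewrite ltnNge; apply/negP => /share_le.
  rewrite shareM shareD share1 addrC => /halves_bound.
  by move=> /(_ (share0 _) (share0 _)); rewrite leNgt XYgt.
have [? ?] := major_minor_size wh0; have [? ?] := major_minor_size wx0.
(* If either maximum came from elsewhere, the half and third bounds would give
   [2 * (X + Y) <= N]. *)
have [XE YE] : X = major h0 /\ Y = minor h0 by rewrite /X /Y in XYbig *; lia.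
case: (heavy_path_trichotomy wh0); first by lia.
move=> [v' [h [x [y [hp hX hY]]]]].
set s := Node v' h x y in hp.
have ws := on_heavy_path_well_formed hp wh0.
have [[wh wx wy] /andP[yx xh]] := well_formed_node ws.
have sE := tree_size_node v' h x y; rewrite -/s in sE.
have sh := on_heavy_path_size hp.
have st : s <> t by move=> st; move: sh; rewrite st -/N tE; lia.
have sN : (tree_size s <= N)%N by rewrite tE; lia.
set e := (N - tree_size s)%N.
have [e_le H1 H2] : [/\ (e <= maxn (tree_size y) (tree_size h)./2)%N,
    (share N e / 2) `^ (4 / 7) + share N (tree_size y) `^ (4 / 7) +
      (share N (tree_size h) / 3) `^ (4 / 7) <= 98 / 100 &
    (share N e / 2) `^ (4 / 7) + (share N (tree_size h) / 2) `^ (4 / 7) +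
      (share N (tree_size h) / 3) `^ (4 / 7) <= 98 / 100].
  have sum : share N (tree_size h) + share N (tree_size x) +
      share N (tree_size y) + share N e <= 1.
    by rewrite -!shareD -share1; apply: share_le; lia.
  have back a b : share N a <= share N b -> (a <= b)%N.
    by rewrite ler_pM2r ?invr_gt0 ?ltr0n // ler_nat.
  have yx' := share_le _ _ yx; have xh' := share_le _ _ xh.
  have XYgt' : 98 / 100 < share N (tree_size x) `^ (4 / 7) +
     share N (minor h0) `^ (4 / 7).
    by rewrite addrC -hX -XE -YE.
  case: hY => [yE|hY].
    rewrite yE in XYgt'.
    have [ey le1 le2] := balanced_bound (share0 _) yx' xh' (share0 _) sum XYgt'.
    by split; [rewrite leq_max (back _ _ ey)|exact: le1|exact: le2].
  have hY' : share N (minor h0) <= share N (tree_size h) / 3.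
    by have := share_le _ _ hY; rewrite shareM; lra.
  have XYgt2 := lt_le_trans XYgt' (lerD (lexx _) (le_powR47 (share0 _) hY')).
  have [eh le1 le2] :=
    two_heavy_bound (share0 _) (share0 _) xh' (share0 _) sum XYgt2.
  have {}eh : share N (2 * e) <= share N (tree_size h) by rewrite shareM.
  split; [|exact: le1|exact: le2].
  by rewrite leq_max (half_le _ _ (back _ _ eh)) orbT.
have gs := top_drawable_thirds mono IH ws sN.
have tp : on_heavy_path s t by exact: on_heavy_path_step.
(* Whatever else hangs on the side of [s] has size at most [e] and fits into the rows reserved for
   [s]. *)
have e_le' : (row_bound e <= (row_bound (tree_size h %/ 3) +
      row_bound (maxn (tree_size y) (tree_size h)./2)).+1)%N.
  exact: leqW (leq_trans (mono _ _ e_le) (leq_addl _ _)).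
have [_ hang] :=
  hang_heavy_subtree mono IH tp st wt (leqnn _) (leqnn _) e_le' gs.
apply: hang; rewrite -/e.
(* The two spare rows are the row of the path in [t] and that of the path in [s]. *)
apply: sum_lt; apply: row_bound_add3 => //.
have E2 : share N e./2 `^ (4 / 7) <= (share N e / 2) `^ (4 / 7).
  apply: le_powR47 => //.
  have := share_le _ _ (half_mul e).
  by rewrite shareM; lra.
have E3 : share N (tree_size h %/ 3) `^ (4 / 7) <=
    (share N (tree_size h) / 3) `^ (4 / 7).
  apply: le_powR47 => //.
  have := share_le _ _ (third_mul (tree_size h)).
  by rewrite shareM; lra.
(* The maximum is the size of [y] or half that of [h]; these are the cases of [H1] and [H2]. *)
case: leqP => _; last by lra.
have : share N (tree_size h)./2 `^ (4 / 7) <=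
    (share N (tree_size h) / 2) `^ (4 / 7).
  apply: le_powR47 => //.
  have := share_le _ _ (half_mul (tree_size h)).
  by rewrite shareM; lra.
by lra.
Qed.

End HeightBound.

(** * Inductive representation of rooted trees *)

Section RootedTrees.
Variables (V : finType) (root : V) (arc : rel V).
Hypothesis arc_tree : rooted_tree root arc.
Implicit Types (u v w c : V) (t : ttree V) (cs : seq V) (ts : seq (ttree V)).

Lemma parent_uniq u u' v : arc u v -> arc u' v -> u = u'.
Proof.
move=> uv uv'; have [_ /(_ v) deg] := arc_tree.
have le1 : (#|[set u | arc u v]%SET| <= 1)%N by rewrite deg; case: ifP.
by apply: (card_le1_eqP le1); rewrite inE.
Qed.

Lemma root_no_parent u : arc u root -> False.
Proof.
have [_ /(_ root)] := arc_tree; rewrite eqxx => /eqP.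
by rewrite cards_eq0 => /eqP /setP /(_ u); rewrite !inE => ->.
Qed.

Lemma connect_last v w : connect arc v w ->
  w = v \/ exists2 p, connect arc v p & arc p w.
Proof.
case/connectP => p; case/lastP: p => [_ ->|p z]; first by left.
rewrite rcons_path last_rcons => /andP[vp az] ->; right.
by exists (last v p) => //; apply/connectP; exists p.
Qed.

(** Going back along the path from the root to [u], unique parents keep every node on the cycle, and
    finally the root, which has no parent. *)
Lemma arc_acyclic u v : arc u v -> connect arc v u -> False.
Proof.
move=> uv vu; have [/(_ u)/connectP[p rp uE] _] := arc_tree.
have {uE} : connect arc v (last root p) /\ connect arc (last root p) u.
  by rewrite -uE.
elim/last_ind: p rp => [|p w IH].
  move=> _ [/= /connect_last[rv|[z _ /root_no_parent//]] _].
  by apply: (@root_no_parent u); rewrite rv.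
rewrite rcons_path last_rcons => /andP[rp aw].
move=> [/connect_last[wv _|[z vz zw] wu]].
  apply: (IH rp); rewrite wv in aw; rewrite (parent_uniq aw uv).
  by split.
apply: (IH rp); rewrite (parent_uniq aw zw); split=> //.
exact: connect_trans (connect1 zw) wu.
Qed.

Lemma arc_asym u v : arc u v -> arc v u -> False.
Proof. by move=> uv vu; apply: (arc_acyclic uv); exact: connect1. Qed.

Lemma ancestors_comparable u v w :
  connect arc u w -> connect arc v w -> connect arc u v || connect arc v u.
Proof.
case/connectP=> p up -> {w}.
elim/last_ind: p up => [_ /= -> |p w IH]; first by rewrite orbT.
rewrite rcons_path last_rcons => /andP[up aw] /connect_last[wv|[z vz zw]].
  suff -> : connect arc u v by [].
  rewrite -wv; apply: connect_trans (connect1 aw).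
  by apply/connectP; exists p.
by apply: (IH up); rewrite (parent_uniq aw zw).
Qed.

Lemma siblings_disjoint v c c' w : arc v c -> arc v c' -> c != c' ->
  connect arc c w -> connect arc c' w -> False.
Proof.
move=> vc vc' /eqP cc' cw c'w.
have [] := orP (ancestors_comparable cw c'w) => /connect_last[c'E|[z zc az]].
- by apply: cc'.
- by apply: (arc_acyclic vc); rewrite (parent_uniq vc' az).
- by apply: cc'.
- by apply: (arc_acyclic vc'); rewrite (parent_uniq vc az).
Qed.

Lemma connect_children v w :
  connect arc v w = (w == v) || has (connect arc ^~ w) (enum (children arc v)).
Proof.
apply/idP/orP.
  move=> /connectP[[_ /= ->|c p /= /andP[vc cp] ->]].
  - by left.
  - right; apply/hasP; exists c; first by rewrite mem_enum inE.
    by apply/connectP; exists p.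
move=> [/eqP->|/hasP[c]].
- exact: connect0.
- by rewrite mem_enum inE => vc; apply: connect_trans (connect1 vc).
Qed.

Definition represents c t : Prop :=
  [/\ exists h x y, t = Node c h x y, well_formed t,
      forall w, (w \in nodes t) = connect arc c w &
      forall e, (e \in edges t) = connect arc c e.1 && arc e.1 e.2].

Lemma represent_forest (f : V -> ttree V) v cs :
  uniq cs -> {subset cs <= children arc v} ->
  (forall c, c \in cs -> represents c (f c)) ->
  let ts := map f cs in
  [/\ all (@well_formed V) ts, uniq (flatten (map (@nodes V) ts)),
    forall w, (w \in flatten (map (@nodes V) ts)) =
              has (connect arc ^~ w) cs,
    forall e, (e \in flatten (map (@edges V) ts)) =
              has (connect arc ^~ e.1) cs && arc e.1 e.2 &
    flatten (map (link v) ts) = [seq (v, c) | c <- cs]].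
Proof.
elim: cs => [|c cs IH] //= /andP[ccs ucs] sub rep.
have [||wf un mn me ml] := IH ucs.
- by move=> c' c'cs; apply: sub; rewrite inE c'cs orbT.
- by move=> c' c'cs; apply: rep; rewrite inE c'cs orbT.
have [|[h [x [y tE]]] wt nt et] := rep c; first by rewrite inE eqxx.
split=> //=.
- by rewrite wt wf.
- rewrite cat_uniq un andbT; have /andP[-> _] := wt.
  apply/hasPn => w; rewrite mn => /hasP[c' c'cs c'w]; rewrite /= nt.
  apply/negP => cw; apply: (@siblings_disjoint v c c' w) => //.
  + by have := sub c; rewrite !inE eqxx => /(_ isT).
  + by have := sub c'; rewrite !inE c'cs orbT => /(_ isT).
  + by apply: contraNneq ccs => ->.
- by move=> w; rewrite mem_cat nt mn.
- by move=> e; rewrite mem_cat et me -andb_orl.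
- by rewrite ml tE.
Qed.

(** Appending [Leaf] adds nothing to the flattened lists and, having size 0, keeps the order
    decreasing. *)
Lemma pad_three ts : (size ts <= 3)%N -> all (@well_formed V) ts ->
  sorted (fun t t' => tree_size t' <= tree_size t)%N ts ->
  exists h x y, [/\ all (@well_formed V) [:: h; x; y],
    (tree_size y <= tree_size x <= tree_size h)%N,
    flatten (map (@nodes V) [:: h; x; y]) = flatten (map (@nodes V) ts),
    flatten (map (@edges V) [:: h; x; y]) = flatten (map (@edges V) ts) &
    forall v, flatten (map (link v) [:: h; x; y]) = flatten (map (link v) ts)].
Proof.
case: ts => [|h [|x [|y []]]] //= _ wf sts.
- by exists Leaf, Leaf, Leaf.
- by exists h, Leaf, Leaf.
- by exists h, x, Leaf; split=> //=; move: wf sts; rewrite !andbT.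
- by exists h, x, y; split=> //=; rewrite andbT andbC in sts *.
Qed.

Hypothesis arc_ternary : forall v, (#|children arc v| <= 3)%N.

Lemma represent v : exists t, represents v t.
Proof.
have [n vn] := ubnP #|[set w | connect arc v w]%SET|.
elim: n v vn => // n IH v vn.
have vE c : c \in enum (children arc v) = arc v c by rewrite mem_enum inE.
have /boolp.choice[f fE] : forall c, exists t, arc v c -> represents c t.
  move=> c.
  have [vc|vc] := boolP (arc v c); last by exists Leaf.
  have [|t tc] := IH c; last by exists t.
  rewrite -ltnS; apply: leq_trans vn; rewrite ltnS.
  apply: proper_card; apply/properP; split.
    apply/fintype.subsetP => w; rewrite !inE.
    exact: connect_trans (connect1 vc).
  exists v; rewrite inE ?connect0 //.
  by apply/negP => /(arc_acyclic vc).
(* Children are sorted by decreasing subtree size, as [heavy_first] requires. *)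
pose ge := relpre (fun c => tree_size (f c)) geq.
have ge_total : total ge by move=> c c'; exact: leq_total.
pose cs := sort ge (enum (children arc v)).
have csE c : (c \in cs) = arc v c by rewrite mem_sort vE.
have [|c|c|wf un mn me ml] := @represent_forest f v cs.
- by rewrite sort_uniq enum_uniq.
- by rewrite csE inE.
- by rewrite csE; exact: fE.
have [||h [x [y [wf3 ord pn ee el]]]] := pad_three _ wf.
- by rewrite size_map size_sort -cardE.
- by rewrite sorted_map; exact: sort_sorted.
have nE w : (w \in nodes (Node v h x y)) = connect arc v w.
  rewrite connect_children -(eq_has_r (mem_sort ge _)) -mn -pn /= cats0.
  by rewrite inE.
exists (Node v h x y); split=> //.
- by exists h, x, y.
- move: wf3; rewrite /well_formed /= andbT.
  move=> /and3P[/andP[_ ->] /andP[_ ->] /andP[_ ->]].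
  move: un; rewrite -pn /= cats0 => ->; rewrite !andbT ord andbT.
  have -> : (v \in nodes h ++ nodes x ++ nodes y) =
      (v \in flatten (map (@nodes V) [:: h; x; y])) by rewrite /= cats0.
  rewrite pn mn; apply/hasPn => c; rewrite csE => vc.
  by apply/negP => /(arc_acyclic vc).
- move=> e; have -> : (e \in edges (Node v h x y)) =
      (e \in flatten (map (link v) [:: h; x; y])) ||
      (e \in flatten (map (@edges V) [:: h; x; y])).
    by rewrite /= !(mem_cat, in_nil); do !case: (_ \in _).
  rewrite ee el ml me connect_children.
  rewrite -(eq_has_r (mem_sort ge (enum (children arc v)))) andb_orl.
  congr (_ || _).
  case: e => a b /=; apply/mapP/andP => [[c]|[/eqP-> ab]].
    by rewrite csE => vc [-> ->].
  by exists b; rewrite ?csE.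
Qed.

End RootedTrees.

(** * From the grid to the real plane *)

Section RealDrawings.
Variables (R : realType) (V : finType) (arc : rel V) (pos : V -> int * int).
Variables (N : seq V) (E : seq (V * V)).
Hypothesis all_nodes : forall v, v \in N.
Hypothesis all_arcs : forall e, (e \in E) = arc e.1 e.2.
Implicit Types (p : R * R) (e f : V * V) (z k : int) (x : R).

(** Edges have integer ends, so rounding a point of an edge stays in its bounding box. The
    hypotheses cover the floor, the ceiling and integer coordinates alike. *)
Lemma edge_segment_on_edge e p z k : edge_segment pos e p ->
  (forall m : int, m%:~R <= p.1 -> m <= z) ->
  (forall m : int, p.1 <= m%:~R -> z <= m) ->
  (forall m : int, m%:~R <= p.2 -> m <= k) ->
  (forall m : int, p.2 <= m%:~R -> k <= m) ->
  on_edge pos e (z, k).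
Proof.
case: p => p1 p2 [t [/= /andP[t0 t1] E1 E2]] zl zr kl kr.
have conv (a b q : R) : q = (1 - t) * a + t * b ->
    (a <= q) && (q <= b) || (b <= q) && (q <= a).
  by move=> ->; have [ab|ba] := leP a b; apply/orP; [left|right];
    apply/andP; split; nra.
rewrite /on_edge /on_segment /between /=.
have /orP[/andP[/zl -> /zr ->]|/andP[/zl -> /zr ->]] := conv _ _ _ E1;
  have /orP[/andP[/kl -> /kr ->]|/andP[/kl -> /kr ->]] := conv _ _ _ E2;
  by rewrite ?orbT.
Qed.

Lemma floor_between x : (forall m : int, m%:~R <= x -> m <= Num.floor x) /\
  (forall m : int, x <= m%:~R -> Num.floor x <= m).
Proof.
split=> m; first by rewrite floor_ge_int.
by move=> xm; rewrite -(ler_int R) (le_trans _ xm) // floor_le.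
Qed.

Lemma ceil_between x : (forall m : int, m%:~R <= x -> m <= Num.ceil x) /\
  (forall m : int, x <= m%:~R -> Num.ceil x <= m).
Proof.
split=> m; last by rewrite ceil_le_int.
by move=> mx; rewrite -(ler_int R) (le_trans mx) // ceil_ge.
Qed.

Lemma int_between k : (forall m : int, m%:~R <= k%:~R :> R -> m <= k) /\
  (forall m : int, k%:~R <= m%:~R :> R -> k <= m).
Proof. by split=> m; rewrite ler_int. Qed.

(* A common point of two edges has its floor and its ceiling on both of them;
   if these differ, the two edges have the same end-nodes. *)
Lemma grid_planar_drawing : (forall u v, arc u v -> arc v u -> False) ->
  grid_planar N E pos -> planar_orthogonal_drawing R arc pos.
Proof.
move=> asym [p1 p2 p3 p4 p5].
have edgeP e : is_edge arc e -> e \in E by rewrite all_arcs.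
split.
- by move=> u v; apply: p1.
- by move=> e /edgeP /p3.
- move=> e f eA fA ef p pe pf.
  have [fl1 fr1] := floor_between p.1; have [fl2 fr2] := floor_between p.2.
  have [cl1 cr1] := ceil_between p.1; have [cl2 cr2] := ceil_between p.2.
  have [w [we wf wq]] := p4 _ _ _ (edgeP _ eA) (edgeP _ fA) ef
    (edge_segment_on_edge pe fl1 fr1 fl2 fr2)
    (edge_segment_on_edge pf fl1 fr1 fl2 fr2).
  have [w' [we' wf' wq']] := p4 _ _ _ (edgeP _ eA) (edgeP _ fA) ef
    (edge_segment_on_edge pe cl1 cr1 cl2 cr2)
    (edge_segment_on_edge pf cl1 cr1 cl2 cr2).
  have [ww|ww] := eqVneq w w'.
    exists w; split=> //; rewrite /Defs.point -wq /=.
    move: wq'; rewrite -ww -wq => -[c1 c2].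
    have exact x : Num.ceil x = Num.floor x -> x = (Num.floor x)%:~R.
      move=> cf; apply/eqP; rewrite eq_le floor_le andbT.
      by rewrite -cf ceil_ge.
    by rewrite -(exact _ c1) -(exact _ c2); case: (p).
  (* Both edges join [w] and [w']; being distinct they are opposite arcs, which [asym] excludes. *)
  have ends g : incident w g -> incident w' g -> g = (w, w') \/ g = (w', w).
    case: g => a b; rewrite /incident /= => /orP[]/eqP wa /orP[]/eqP wb;
      rewrite wa wb ?eqxx // in ww *; by [left|right].
  move: ef eA fA; have [->|->] := ends e we we'; have [->|->] := ends f wf wf';
    rewrite ?eqxx // /is_edge /=.
  + by move=> _ ab /(asym _ _ ab).
  + by move=> _ ab /(asym _ _ ab).
- move=> e /edgeP eE w we; apply: (p5 _ _ eE (all_nodes w)).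
  have [l1 r1] := int_between (pos w).1; have [l2 r2] := int_between (pos w).2.
  rewrite [pos w]surjective_pairing.
  exact: edge_segment_on_edge we l1 r1 l2 r2.
Qed.

Lemma card_int_interval (A : set int) (a b : nat) :
  (forall k, A k -> - a%:Z <= k <= b%:Z) -> (#|` fset_set A| <= (a + b).+1)%N.
Proof.
move=> Aab; pose s := [seq i%:Z - a%:Z | i <- iota 0 (a + b).+1].
have As k : A k -> k \in s.
  move=> /Aab kab; apply/mapP; exists (absz (k + a%:Z)); last by lia.
  by rewrite mem_iota; lia.
have Afin : finite_set A by apply: sub_finite_set (finite_seq s) => k /As.
apply: leq_trans (_ : #|` [fset k in s]%fset| <= _)%N.
  apply: fsubset_leq_card; apply/fsubsetP => k.
  by rewrite in_fset_set // inE => /As ks; rewrite !inE.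
rewrite card_fseq (leq_trans (size_undup _)) //.
by rewrite size_map size_iota.
Qed.

Variables a b u d : nat.
Hypothesis bounded : forall q, occupied N E pos q -> box a b u d q.

(** When one coordinate of a point on an edge is an integer, taking the floor of the other gives an
    occupied grid point on the same line. *)
Lemma drawing_points_box p (k : int) : drawing_points arc pos p ->
  (p.1 = k%:~R -> - a%:Z <= k <= b%:Z) /\ (p.2 = k%:~R -> - u%:Z <= k <= d%:Z).
Proof.
move=> [[v ->]|[e ee pe]].
  have [] : box a b u d (pos v) by apply: bounded; left; exists v.
  by rewrite /Defs.point /=; split=> /eqP; rewrite eqr_int => /eqP <-.
have [l r] := int_between k.
have eE : e \in E by rewrite all_arcs.
split=> pk.
- have [l' r'] := floor_between p.2.
  have ke : on_edge pos e (k, Num.floor p.2).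
    by apply: (edge_segment_on_edge pe) => //; rewrite pk.
  by have [] : box a b u d (k, Num.floor p.2)
    by apply: bounded; right; exists e.
- have [l' r'] := floor_between p.1.
  have ke : on_edge pos e (Num.floor p.1, k).
    by apply: (edge_segment_on_edge pe) => //; rewrite pk.
  by have [] : box a b u d (Num.floor p.1, k)
    by apply: bounded; right; exists e.
Qed.

Lemma width_le : (width R arc pos <= (a + b).+1)%N.
Proof.
apply: card_int_interval => k [p pp pk].
by have [/(_ pk)] := drawing_points_box k pp.
Qed.

Lemma height_le : (height R arc pos <= (u + d).+1)%N.
Proof.
apply: card_int_interval => k [p pp pk].
by have [_ /(_ pk)] := drawing_points_box k pp.
Qed.

End RealDrawings.

Theorem theorem1 (R : realType) :
  exists2 C : R, 0 < C &
  forall (V : finType) (root : V) (arc : rel V), ternary_tree root arc ->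
  let n := #|V|%:R : R in
  exists pos : V -> int * int,
    [/\ planar_orthogonal_drawing R arc pos,
        (width R arc pos)%:R <= C * n,
        (height R arc pos)%:R <= C * n `^ (576 / 1000) &
        (area R arc pos)%:R <= C * n `^ (1576 / 1000)].
Proof.
exists 100 => // V root arc [tree ternary] n.
have [t [[h [x [y tE]]] wt nt et]] := represent tree ternary root.
have reach : forall v, connect arc root v by case: tree.
have all_nodes v : v \in nodes t by rewrite nt reach.
have all_arcs e : (e \in edges t) = arc e.1 e.2 by rewrite et reach.
have szt : tree_size t = #|V|.
  have /andP[/card_uniqP un _] := wt.
  by rewrite /tree_size -un; apply: eq_card => v; rewrite all_nodes.
have := top_drawable_row_bound R wt.
rewrite szt {1}tE => -[a [b [u [d [ab ud]]]]]; rewrite -tE szt in ab *.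
move=> [pos [planar _ _ bounded]].
have {}bounded q : occupied (nodes t) (edges t) pos q -> box a b u d q.
  by move=> /bounded[].
have wn : (width R arc pos)%:R <= n.
  rewrite ler_nat.
  by apply: leq_trans (width_le R all_nodes all_arcs bounded) _.
have n1 : 1 <= n.
  by rewrite ler1n; apply: leq_ltn_trans (leq0n _) ab.
have n0 : 0 <= n by apply: le_trans n1.
have hn : (height R arc pos)%:R <= 100 * n `^ (576 / 1000).
  have hk := leq_trans (height_le R all_nodes all_arcs bounded) ud.
  rewrite -(ler_nat R) in hk; apply: le_trans hk _.
  apply: le_trans (row_bound_le R _) _; rewrite ler_pM2l //.
  (* The exponent may grow from [4/7] to [0.576] because [1 <= n]. *)
  by rewrite ler_powR //; lra.
exists pos; split=> //.
- exact: grid_planar_drawing (arc_asym tree) planar.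
- by apply: le_trans wn _; rewrite ler_peMl ?ler1n.
- rewrite /area natrM; apply: le_trans (ler_pM _ _ wn hn) _ => //.
  rewrite mulrCA ler_pM2l //.
  have -> : 1576 / 1000 = 1 + 576 / 1000 :> R by lra.
  rewrite powRD ?powRr1 //; apply/implyP => _.
  by rewrite gt_eqF // (lt_le_trans ltr01).
Qed.
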